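(* Let $A=(a_{i,j})_{i,j\ge 0}$ and $X=(x_{i,j})_{i,j\ge 0}$ be two arrays with non-negative real entries such that every row of $A$ and every row of $X$ is log-concave (boundary terms being handled by the zero convention). Then $$\mathcal{L}(A\odot X)\;\ge\;\mathcal{L}(A)\odot\mathcal{L}(X)$$ entrywise.
   Context: A sequence $(a_j)_{j\ge 0}$ of non-negative real numbers is log-concave if $a_j^2\ge a_{j-1}a_{j+1}$ for all $j\ge 1$, with the zero convention that $a_j=0$ for $j<0$ or $j$ outside the support. The log-concavity operator $\mathcal{L}$ acts row-wise on an array $A=(a_{i,j})_{i,j\ge 0}$ by $\mathcal{L}(A)_{i,j}=a_{i,j}^2-a_{i,j-1}a_{i,j+1}$, where terms with negative or out-of-range indices are taken to be zero. The symbol $\odot$ denotes the Hadamard (entrywise) product of arrays. *)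

(* Defs.v *)
From mathcomp Require Import all_boot all_order all_algebra.
From mathcomp Require Import reals.

Set Implicit Arguments.
Unset Strict Implicit.
Unset Printing Implicit Defensive.

Import Order.TTheory GRing.Theory Num.Theory.

Local Open Scope ring_scope.

(* An array (a_{i,j})_{i,j >= 0} is a function [nat -> nat -> R], and its i-th
   row is the partial application [A i].  A finite array is one padded with
   zeros, so that the only index not covered by the type is j = -1. *)
Definition array (R : realType) := nat -> nat -> R.

(* [prev a j] is a_{j-1}, with the convention a_{-1} = 0. *)
Definition prev (R : realType) (a : nat -> R) (j : nat) : R :=
  if j is k.+1 then a k else 0.

Definition log_concave (R : realType) (a : nat -> R) : Prop :=
  forall j : nat, (1 <= j)%N -> a j ^+ 2 >= prev a j * a j.+1.

Definition log_concavity_op (R : realType) (A : array R) : array R :=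
  fun i j => A i j ^+ 2 - prev (A i) j * A i j.+1.

Definition hadamard (R : realType) (A B : array R) : array R :=
  fun i j => A i j * B i j.

(* Main.v *)
(* With p = a_j^2 >= q = a_{j-1} a_{j+1} >= 0 and s = x_j^2 >= t = x_{j-1} x_{j+1} >= 0,
   the difference of the two sides is
   (p s - q t) - (p - q)(s - t) = (p - q) t + q (s - t) >= 0. *)
Require Import Defs.
From mathcomp Require Import all_boot all_order all_algebra.
From mathcomp Require Import reals.
From mathcomp Require Import ring.

Import Order.TTheory GRing.Theory Num.Theory.

Local Open Scope ring_scope.

(** The Hadamard product multiplies squares with squares and neighbour products with neighbour
    products, so the claim is a scalar inequality at each entry. *)

Theorem theorem4p1 (R : realType) (A X : array R)
    (A_ge0 : forall i j : nat, 0 <= A i j)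
    (X_ge0 : forall i j : nat, 0 <= X i j)
    (A_lc : forall i : nat, log_concave (A i))
    (X_lc : forall i : nat, log_concave (X i)) :
  forall i j : nat,
    log_concavity_op (hadamard A X) i j
      >= hadamard (log_concavity_op A) (log_concavity_op X) i j.
Proof.
move=> i [|j]; rewrite /log_concavity_op /hadamard /=.
  (* At column 0 every [prev] is 0, and both sides equal the product of the squares. *)
  by rewrite !mul0r !subr0 exprMn.
have /= Aj := A_lc i j.+1 isT; have /= Xj := X_lc i j.+1 isT.
rewrite -subr_ge0.
have -> : (A i j.+1 * X i j.+1) ^+ 2 - A i j * X i j * (A i j.+2 * X i j.+2)
    - (A i j.+1 ^+ 2 - A i j * A i j.+2) * (X i j.+1 ^+ 2 - X i j * X i j.+2)
  = (A i j.+1 ^+ 2 - A i j * A i j.+2) * (X i j * X i j.+2)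
    + A i j * A i j.+2 * (X i j.+1 ^+ 2 - X i j * X i j.+2) by ring.
(* Each summand is a gap, nonnegative by [Aj] or [Xj], times a product of two nonnegative entries of
   the other array. *)
by rewrite addr_ge0 // mulr_ge0 ?subr_ge0 // mulr_ge0.
Qed.
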